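(* Let $(\theta_x,\theta_t)\in\Theta_{L_x,L_t}^{\mathrm{low},\mathrm{f}}$. With the assumption of periodic boundary conditions in space and time, the two-grid operator with full space-time coarsening $$\mathcal M^{\mathrm f}_{\tau_L,h_L}:=\mathcal S_{\tau_L,h_L}^{\nu_2}\Big[I-\mathcal P_{\mathrm f}^{L_x,L_t}\big(\mathcal L_{2\tau_L,2h_L}\big)^{-1}\mathcal R_{\mathrm f}^{L_x,L_t}\mathcal L_{\tau_L,h_L}\Big]\mathcal S_{\tau_L,h_L}^{\nu_1}$$ satisfies the mapping property $$\mathcal M^{\mathrm f}_{\tau_L,h_L}:\mathcal E_{L_x,L_t}(\theta_x,\theta_t)\to\mathcal E_{L_x,L_t}(\theta_x,\theta_t),$$ with the mapping of coefficient matrices $$\begin{pmatrix} U_1 \\ U_2 \\ U_3 \\ U_4 \end{pmatrix}\mapsto\widetilde{\mathcal M}^{\mathrm f}_\mu(\theta_x,\theta_t)\begin{pmatrix} U_1 \\ U_2 \\ U_3 \\ U_4 \end{pmatrix}$$ and the iteration matrix $$\widetilde{\mathcal M}^{\mathrm f}_\mu(\theta_x,\theta_t):=\big(\widetilde{\mathcal S}_{\tau_L,h_L}(\theta_x,\theta_t)\big)^{\nu_2}\,\widetilde{\mathcal K}_{\mathrm f}(\theta_x,\theta_t)\,\big(\widetilde{\mathcal S}_{\tau_L,h_L}(\theta_x,\theta_t)\big)^{\nu_1}\in\mathbb{C}^{4N_t\times4N_t},$$ where $$\widetilde{\mathcal K}_{\mathrm f}(\theta_x,\theta_t):=I_{4N_t}-\widetilde{\mathcal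 P}_{\mathrm f}(\theta_x,\theta_t)\big(\widetilde{\mathcal L}^{\mathrm f}_{2\tau_L,2h_L}(2\theta_x,2\theta_t)\big)^{-1}\widetilde{\mathcal R}_{\mathrm f}(\theta_x,\theta_t)\,\widetilde{\mathcal L}_{\tau_L,h_L}(\theta_x,\theta_t).$$
   Context: **Discretization.** The problem is the one-dimensional heat equation on $(0,1)\times(0,T)$, discretized by piecewise linear finite elements of mesh size $h_L$ in space and a discontinuous Galerkin method of degree $p_t\in\mathbb{N}_0$ with step $\tau_L$ in time; $N_t=p_t+1$, $\mu=\tau_Lh_L^{-2}$. $N_{L_x}$ (spatial unknowns) and $N_{L_t}$ (time steps) are even; $N_{L_t-1}=N_{L_t}/2$, and $N_{L_x-1}$ is the number of spatial unknowns on the coarse spatial grid of mesh size $2h_L$. $\nu_1,\nu_2\in\mathbb{N}$ are the numbers of pre- and post-smoothing steps and $\omega_t$ is the damping parameter of the smoother. For $\tau>0$ and a basis $\{\psi_k\}_{k=1}^{N_t}$ of the polynomials of degree $\le p_t$ on $(0,\tau)$: $K_\tau[k,\ell]=-\int_0^\tau\psi_\ell\psi_k'\,dt+\psi_\ell(\tau)\psi_k(\tau)$, $M_\tau[k,\ell]=\int_0^\tau\psi_\ell\psi_k\,dt$, $N_\tau[k,\ell]=\psi_\ell(\tau)\psi_k(0)$. Matrices with index $\tau_L$ use a basis $\{\psi_k\}$ on $(0,\tau_L)$, those with index $2\tau_L$ a basis $\{\widetilde\psi_k\}$ on $(0,2\tau_L)$. Vectors are $u=(u_{n,r})$ with $u_{n,r}\in\mathbb{C}^{N_t}$,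 $n$ the time-step index and $r$ the spatial index; fine vectors have $n\le N_{L_t}$, $r\le N_{L_x}$, coarse vectors have $n\le N_{L_t-1}$, $r\le N_{L_x-1}$. Periodic boundary conditions in space-time, $u(t,0)=u(t,1)$ for $t\in(0,T)$ and $u(0,x)=u(T,x)$ for $x\in(0,1)$, mean that both indices are read cyclically, so that relations valid at interior indices are used at all indices. Set $(M_hu)_{n,r}=\frac h6(u_{n,r-1}+4u_{n,r}+u_{n,r+1})$, $(K_hu)_{n,r}=\frac1h(-u_{n,r-1}+2u_{n,r}-u_{n,r+1})$. The system operator is $(\mathcal L_{\tau,h}u)_{n,r}=K_\tau(M_hu)_{n,r}+M_\tau(K_hu)_{n,r}-N_\tau(M_hu)_{n-1,r}$; $\mathcal L_{\tau_L,h_L}$ acts on fine and $\mathcal L_{2\tau_L,2h_L}$ on coarse vectors. The block diagonal part is $(D_{\tau,h}u)_{n,r}=K_\tau(M_hu)_{n,r}+M_\tau(K_hu)_{n,r}$, and the damped block Jacobi smoother with $\nu$ steps is $\mathcal S^\nu_{\tau_L,h_L}=[I-\omega_tD_{\tau_L,h_L}^{-1}\mathcal L_{\tau_L,h_L}]^\nu$. **Transfer operators.** $R_1^\top=M_{\tau_L}^{-1}\widetilde M^1$, $R_2^\top=M_{\tau_L}^{-1}\widetilde M^2$ with $\widetilde M^1[k,\ell]=\int_0^{\tau_L}\widetilde\psi_\ell(t)\psi_k(t)\,dt$, $\widetilde M^2[k,\ell]=\int_{\tau_L}^{2\tau_L}\widetilde\psi_\ell(t)\psi_k(t-\tau_L)\,dt$.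 The time restriction is $(\mathcal R^{L_t}u)_n=R_1u_{2n-1}+R_2u_{2n}$, with prolongation $\mathcal P^{L_t}=(\mathcal R^{L_t})^\top$. The space restriction from fine to coarse spatial unknowns is $$\mathcal R_x^{L_x}=\frac12\begin{pmatrix}2&1&&&&&\\&1&2&1&&&\\&&\ddots&\ddots&\ddots&&\\&&&1&2&1&\\&&&&&1&2\end{pmatrix},\qquad \mathcal P_x^{L_x}=(\mathcal R_x^{L_x})^\top .$$ Then $\mathcal R_{\mathrm f}^{L_x,L_t}=\mathcal R_x^{L_x}\otimes\mathcal R^{L_t}$ and $\mathcal P_{\mathrm f}^{L_x,L_t}=\mathcal P_x^{L_x}\otimes\mathcal P^{L_t}$ (the first factor acting on the spatial index, the second on the time index). The Fourier symbols of $\mathcal R_x^{L_x}$ and $\mathcal P_x^{L_x}$ are $\hat{\mathcal R}_x(\theta_x)=1+\cos\theta_x$ and $\hat{\mathcal P}_x(\theta_x)=\frac12(1+\cos\theta_x)$. **Frequencies and Fourier spaces.** $\Theta_{L_x,L_t}=\{(\frac{2k\pi}{N_{L_x}},\frac{2\ell\pi}{N_{L_t}}):k=1-\frac{N_{L_x}}2,\dots,\frac{N_{L_x}}2,\ \ell=1-\frac{N_{L_t}}2,\dots,\frac{N_{L_t}}2\}$, $\Theta_{L_x,L_t}^{\mathrm{low},\mathrm f}=\Theta_{L_x,L_t}\cap(-\frac\pi2,\frac\pi2]^2$, $\gamma(\theta)=\theta-\mathrm{sign}(\theta)\pi$ with $\mathrm{sign}(0)=-1$. $\Phi(\theta_x,\theta_t)$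 is the (fine or coarse) vector with $\Phi_{n,r}(\theta_x,\theta_t)=e^{\mathrm i n\theta_t}e^{\mathrm i r\theta_x}(1,\dots,1)^\top\in\mathbb{C}^{N_t}$. $\mathcal E_{L_x,L_t}(\theta_x,\theta_t)$ (space of harmonics) is the set of fine vectors $\psi$ with $\psi_{n,r}=U_1\Phi_{n,r}(\theta_x,\theta_t)+U_2\Phi_{n,r}(\gamma(\theta_x),\theta_t)+U_3\Phi_{n,r}(\theta_x,\gamma(\theta_t))+U_4\Phi_{n,r}(\gamma(\theta_x),\gamma(\theta_t))$ for some $U_1,\dots,U_4\in\mathbb{C}^{N_t\times N_t}$, its coefficient matrices. $\Psi_{L_x-1,L_t-1}(2\theta_x,2\theta_t)$ is the set of coarse vectors with $\psi_{n,r}=U\Phi_{n,r}(2\theta_x,2\theta_t)$, $U\in\mathbb{C}^{N_t\times N_t}$; the coarse inverse $(\mathcal L_{2\tau_L,2h_L})^{-1}$ maps this space to itself by multiplying $U$ with $(\widetilde{\mathcal L}^{\mathrm f}_{2\tau_L,2h_L}(2\theta_x,2\theta_t))^{-1}$. **Symbols.** $\beta(\theta_x)=6\frac{1-\cos\theta_x}{2+\cos\theta_x}$; $\hat{\mathcal L}_{\tau,h}(\theta_x,\theta_t)=\frac h3(2+\cos\theta_x)[K_\tau+h^{-2}\beta(\theta_x)M_\tau-e^{-\mathrm i\theta_t}N_\tau]$; $\hat{\mathcal S}_{\tau_L,h_L}(\theta_x,\theta_t)=(1-\omega_t)I_{N_t}+\omega_te^{-\mathrm i\theta_t}(K_{\tau_L}+h_L^{-2}\beta(\theta_x)M_{\tau_L})^{-1}N_{\tau_L}$;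 $\hat{\mathcal R}(\theta_x,\theta_t)=\hat{\mathcal R}_x(\theta_x)\,(e^{-\mathrm i\theta_t}R_1+R_2)$; $\hat{\mathcal P}(\theta_x,\theta_t)=\hat{\mathcal P}_x(\theta_x)\cdot\frac12[e^{\mathrm i\theta_t}R_1^\top+R_2^\top]$; $\big(\widetilde{\mathcal L}^{\mathrm f}_{2\tau_L,2h_L}(2\theta_x,2\theta_t)\big)^{-1}=\big(\hat{\mathcal L}_{2\tau_L,2h_L}(2\theta_x,2\theta_t)\big)^{-1}\in\mathbb{C}^{N_t\times N_t}$. Order the four frequencies as $(\theta_x,\theta_t),(\gamma(\theta_x),\theta_t),(\theta_x,\gamma(\theta_t)),(\gamma(\theta_x),\gamma(\theta_t))$. $\widetilde{\mathcal L}_{\tau_L,h_L}(\theta_x,\theta_t)$ and $\widetilde{\mathcal S}_{\tau_L,h_L}(\theta_x,\theta_t)$ are the block diagonal $4N_t\times4N_t$ matrices with diagonal blocks $\hat{\mathcal L}_{\tau_L,h_L}$, respectively $\hat{\mathcal S}_{\tau_L,h_L}$, at these frequencies; $\widetilde{\mathcal R}_{\mathrm f}(\theta_x,\theta_t)\in\mathbb{C}^{N_t\times4N_t}$ is the block row of the values of $\hat{\mathcal R}$ and $\widetilde{\mathcal P}_{\mathrm f}(\theta_x,\theta_t)\in\mathbb{C}^{4N_t\times N_t}$ the block column of the values of $\hat{\mathcal P}$ at these frequencies. *)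

(* Defs.v *)
From HB Require Import structures.
From mathcomp Require Import all_boot all_order all_algebra.
From mathcomp Require Import all_classical all_reals all_analysis.
From mathcomp Require Import qpoly complex.

Set Implicit Arguments.
Unset Strict Implicit.
Unset Printing Implicit Defensive.

Import Order.TTheory GRing.Theory Num.Theory.

Local Open Scope classical_set_scope.
Local Open Scope ring_scope.
Local Open Scope complex_scope.

Section TimeMatrices.
Context {R : realType} {p : nat}.

(* The inhabitants of {poly_p.+1 R} are the polynomials of size at most p.+1,
   that is, of degree at most p. *)
Definition is_poly_basis (psi : p.+1.-tuple {poly_p.+1 R}) : bool :=
  basis_of fullv psi.

Implicit Types (tau : R) (psi psit : p.+1.-tuple {poly_p.+1 R}).

Definition bfun psi (k : 'I_p.+1) : {poly R} := tnth psi k.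

Local Notation mu := (@lebesgue_measure R).

Definition Ktau tau psi : 'M[R]_p.+1 := \matrix_(k, l)
  ((bfun psi l).[tau] * (bfun psi k).[tau]
   - (\int[mu]_(t in `[0, tau]) ((bfun psi l).[t] * (bfun psi k)^`().[t]))).

Definition Mtau tau psi : 'M[R]_p.+1 := \matrix_(k, l)
  \int[mu]_(t in `[0, tau]) ((bfun psi l).[t] * (bfun psi k).[t]).

Definition Ntau tau psi : 'M[R]_p.+1 := \matrix_(k, l)
  ((bfun psi l).[tau] * (bfun psi k).[0]).

(* Here psi is a basis on (0, tau) and psit one on (0, 2 tau). *)
Definition Mtilde1 tau psi psit : 'M[R]_p.+1 := \matrix_(k, l)
  \int[mu]_(t in `[0, tau]) ((bfun psit l).[t] * (bfun psi k).[t]).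

Definition Mtilde2 tau psi psit : 'M[R]_p.+1 := \matrix_(k, l)
  \int[mu]_(t in `[tau, 2 * tau]) ((bfun psit l).[t] * (bfun psi k).[t - tau]).

Definition R1 tau psi psit : 'M[R]_p.+1 :=
  (invmx (Mtau tau psi) *m Mtilde1 tau psi psit)^T.

Definition R2 tau psi psit : 'M[R]_p.+1 :=
  (invmx (Mtau tau psi) *m Mtilde2 tau psi psit)^T.

End TimeMatrices.

Definition cmx {R : realType} {m n : nat} (A : 'M[R]_(m, n)) : 'M[R[i]]_(m, n) :=
  map_mx (real_complex R) A.

Definition expi {R : realType} (x : R) : R[i] := cos x +i* sin x.

(* u (n, r) is the block u_{n,r}.  Both indices are cyclic: an element of 'I_N
   stands for a residue class modulo N, so that N itself is the ordinal 0;
   ord_pred and ordS are the cyclic predecessor and successor. *)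
Definition gridvec (R : realType) (p Nt Nx : nat) :=
  {ffun 'I_Nt * 'I_Nx -> 'cV[R[i]]_p.+1}.

Section Operators.
Context {R : realType} {p Nt Nx : nat}.
Implicit Types (tau h : R) (psi : p.+1.-tuple {poly_p.+1 R}).
Implicit Types u : gridvec R p Nt Nx.

Definition Mh h u : gridvec R p Nt Nx := [ffun i =>
  (h / 6)%:C *: (u (i.1, ord_pred i.2) + 4 *: u i + u (i.1, ordS i.2))].

Definition Kh h u : gridvec R p Nt Nx := [ffun i =>
  h^-1%:C *: (- u (i.1, ord_pred i.2) + 2 *: u i - u (i.1, ordS i.2))].

Definition blockdiag tau h psi u : gridvec R p Nt Nx := [ffun i =>
  cmx (Ktau tau psi) *m Mh h u i + cmx (Mtau tau psi) *m Kh h u i].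

Definition system tau h psi u : gridvec R p Nt Nx := [ffun i =>
  cmx (Ktau tau psi) *m Mh h u i + cmx (Mtau tau psi) *m Kh h u i
  - cmx (Ntau tau psi) *m Mh h u (ord_pred i.1, i.2)].

(* The inverse is taken in 'End(gridvec R p Nt Nx); blockdiag is linear and,
   for tau, h > 0 and psi a basis, bijective, so it is the two-sided inverse. *)
Definition blockdiag_inv tau h psi : gridvec R p Nt Nx -> gridvec R p Nt Nx :=
  ((linfun (blockdiag tau h psi : gridvec R p Nt Nx -> gridvec R p Nt Nx))^-1)%VF.

Definition smoother tau h psi (omega : R) (nu : nat) :
    gridvec R p Nt Nx -> gridvec R p Nt Nx :=
  iter nu (fun u => u - omega%:C *: blockdiag_inv tau h psi (system tau h psi u)).

End Operators.

Section Transfer.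
Context {R : realType} {p Nt Nx : nat}.
Implicit Types (tau : R) (psi psit : p.+1.-tuple {poly_p.+1 R}).

(* Periodic form of the displayed restriction matrix: row r carries
   1/2 (1, 2, 1) at the cyclic columns 2r - 1, 2r, 2r + 1.  The contributions
   are added up, since for Nx = 2 the outer two columns coincide. *)
Definition Rspace : 'M[R]_(Nx./2, Nx) := \matrix_(r, s)
  (2^-1 * ((s.+1 == r.*2 %[mod Nx])%:R + 2 * (s == r.*2 %[mod Nx])%:R
           + (s == r.*2.+1 %[mod Nx])%:R)).

Definition Pspace : 'M[R]_(Nx, Nx./2) := Rspace^T.

(* Block (n, s) of the time restriction: R1 at s = 2n - 1 and R2 at s = 2n,
   cyclically. *)
Definition Rtime tau psi psit (n : 'I_Nt./2) (s : 'I_Nt) : 'M[R]_p.+1 :=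
  (s.+1 == n.*2 %[mod Nt])%:R *: R1 tau psi psit
  + (s == n.*2 %[mod Nt])%:R *: R2 tau psi psit.

Definition Ptime tau psi psit (s : 'I_Nt) (n : 'I_Nt./2) : 'M[R]_p.+1 :=
  (Rtime tau psi psit n s)^T.

Definition restriction tau psi psit (u : gridvec R p Nt Nx) :
    gridvec R p Nt./2 Nx./2 := [ffun i =>
  \sum_(s < Nt) \sum_(q < Nx)
    (Rspace i.2 q)%:C *: (cmx (Rtime tau psi psit i.1 s) *m u (s, q))].

Definition prolongation tau psi psit (v : gridvec R p Nt./2 Nx./2) :
    gridvec R p Nt Nx := [ffun i =>
  \sum_(n < Nt./2) \sum_(r < Nx./2)
    (Pspace i.2 r)%:C *: (cmx (Ptime tau psi psit i.1 n) *m v (n, r))].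

End Transfer.

Section Frequencies.
Context {R : realType}.
Implicit Types theta : R.

Definition Theta (Nx Nt : nat) : set (R * R) := [set theta |
  exists k l : int,
    [/\ 1 - (Nx./2)%:Z <= k <= (Nx./2)%:Z,
        1 - (Nt./2)%:Z <= l <= (Nt./2)%:Z,
        theta.1 = 2 * k%:~R * pi / Nx%:R &
        theta.2 = 2 * l%:~R * pi / Nt%:R]].

Definition Theta_low (Nx Nt : nat) : set (R * R) :=
  Theta Nx Nt `&` (`]- (pi / 2), pi / 2] `*` `]- (pi / 2), pi / 2]).

(* Num.sg sends 0 to 0, whereas the convention needed here is sign 0 = -1. *)
Definition sign theta : R := if 0 < theta then 1 else -1.

Definition gamma theta : R := theta - sign theta * pi.

Definition harmfreq (thetax thetat : R) : 4.-tuple (R * R) :=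
  [tuple (thetax, thetat); (gamma thetax, thetat);
         (thetax, gamma thetat); (gamma thetax, gamma thetat)].

Definition Phi {p Nt Nx : nat} (theta : R * R) (i : 'I_Nt * 'I_Nx) :
    'cV[R[i]]_p.+1 :=
  (expi (i.1%:R * theta.2) * expi (i.2%:R * theta.1)) *: const_mx 1.

Definition Psi {p Nt Nx : nat} (thetax thetat : R) : set (gridvec R p Nt Nx) :=
  [set v | exists U : 'M[R[i]]_p.+1,
             v = [ffun i => U *m Phi (thetax, thetat) i]].

Definition harmvec {p Nt Nx : nat} (thetax thetat : R)
    (U : 'I_4 -> 'M[R[i]]_p.+1) : gridvec R p Nt Nx :=
  [ffun i => \sum_(j < 4) U j *m Phi (tnth (harmfreq thetax thetat) j) i].

Definition harmonics {p Nt Nx : nat} (thetax thetat : R) :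
    set (gridvec R p Nt Nx) :=
  [set u | exists U : 'I_4 -> 'M[R[i]]_p.+1, u = harmvec thetax thetat U].

End Frequencies.

Section Symbols.
Context {R : realType} {p : nat}.
Implicit Types (tau h omega : R) (psi psit : p.+1.-tuple {poly_p.+1 R}).
Implicit Types theta : R * R.

Definition beta (thetax : R) : R := 6 * ((1 - cos thetax) / (2 + cos thetax)).

Definition Lhat tau h psi theta : 'M[R[i]]_p.+1 :=
  (h / 3 * (2 + cos theta.1))%:C *:
    (cmx (Ktau tau psi) + (h ^- 2 * beta theta.1)%:C *: cmx (Mtau tau psi)
     - expi (- theta.2) *: cmx (Ntau tau psi)).

Definition Shat tau h psi omega theta : 'M[R[i]]_p.+1 :=
  (1 - omega)%:C%:M + (omega%:C * expi (- theta.2)) *: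
    (invmx (cmx (Ktau tau psi)
            + (h ^- 2 * beta theta.1)%:C *: cmx (Mtau tau psi))
     *m cmx (Ntau tau psi)).

Definition Rxhat (thetax : R) : R := 1 + cos thetax.

Definition Pxhat (thetax : R) : R := 2^-1 * (1 + cos thetax).

Definition Rhat tau psi psit theta : 'M[R[i]]_p.+1 :=
  (Rxhat theta.1)%:C *:
    (expi (- theta.2) *: cmx (R1 tau psi psit) + cmx (R2 tau psi psit)).

Definition Phat tau psi psit theta : 'M[R[i]]_p.+1 :=
  (Pxhat theta.1)%:C *: (2^-1 *:
    (expi theta.2 *: cmx (R1 tau psi psit)^T + cmx (R2 tau psi psit)^T)).

(* \sum_(j < 4) p.+1 is the library's size of a 4-block matrix. *)
Local Notation N4 := (\sum_(j < 4) p.+1)%N.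

Definition Ltilde tau h psi (thetax thetat : R) : 'M[R[i]]_N4 :=
  \mxdiag_(j < 4) Lhat tau h psi (tnth (harmfreq thetax thetat) j).

Definition Stilde tau h psi omega (thetax thetat : R) : 'M[R[i]]_N4 :=
  \mxdiag_(j < 4) Shat tau h psi omega (tnth (harmfreq thetax thetat) j).

Definition Rtilde tau psi psit (thetax thetat : R) : 'M[R[i]]_(p.+1, N4) :=
  \mxrow_(j < 4) Rhat tau psi psit (tnth (harmfreq thetax thetat) j).

Definition Ptilde tau psi psit (thetax thetat : R) : 'M[R[i]]_(N4, p.+1) :=
  \mxcol_(j < 4) Phat tau psi psit (tnth (harmfreq thetax thetat) j).

Definition Ltilde_coarse_inv tau h psit (thetax thetat : R) : 'M[R[i]]_p.+1 :=
  invmx (Lhat (2 * tau) (2 * h) psit (2 * thetax, 2 * thetat)).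

Definition Ktilde tau h psi psit (thetax thetat : R) : 'M[R[i]]_N4 :=
  1%:M - Ptilde tau psi psit thetax thetat
         *m Ltilde_coarse_inv tau h psit thetax thetat
         *m Rtilde tau psi psit thetax thetat
         *m Ltilde tau h psi thetax thetat.

Definition Mtilde tau h psi psit omega (nu1 nu2 : nat) (thetax thetat : R) :
    'M[R[i]]_N4 :=
  Stilde tau h psi omega thetax thetat ^+ nu2
  *m Ktilde tau h psi psit thetax thetat
  *m Stilde tau h psi omega thetax thetat ^+ nu1.

End Symbols.

(* f maps E bijectively onto itself, with inverse g. *)
Definition inverse_on {T : Type} (E : set T) (f g : T -> T) : Prop :=
  [/\ set_fun E E f, set_fun E E g, {in E, cancel f g} & {in E, cancel g f}].

(* Under periodic boundary conditions the coarse operator has no global inverse: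
   it annihilates the functions that are constant in space-time.  What enters the
   two-grid operator on a space of harmonics is its inverse on one space Psi,
   so the coarse solver Linv is a parameter here; inverse_on pins it down. *)
Definition twogrid {R : realType} {p Nt Nx : nat} (tau h : R)
    (psi psit : p.+1.-tuple {poly_p.+1 R}) (omega : R) (nu1 nu2 : nat)
    (Linv : gridvec R p Nt./2 Nx./2 -> gridvec R p Nt./2 Nx./2)
    (u : gridvec R p Nt Nx) : gridvec R p Nt Nx :=
  let v := smoother tau h psi omega nu1 u in
  smoother tau h psi omega nu2
    (v - prolongation tau psi psit
           (Linv (restriction tau psi psit (system tau h psi v)))).

(* Main.v *)
Require Import Defs.
From HB Require Import structures.
From mathcomp Require Import all_boot all_order all_algebra.
From mathcomp Require Import all_classical all_reals all_analysis.
From mathcomp Require Import qpoly complex polyorder.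
From mathcomp Require Import ring lra zify.

(* Every operator is diagonalized by the Fourier modes e^{i n theta_t} e^{i r theta_x} w,
   on which it acts by its symbol applied to w.  Restriction aliases the four
   frequencies of a harmonic space to the single coarse frequency (2 theta_x, 2 theta_t),
   and prolongation spreads this coarse mode over the four again, because
   expi (gamma theta) = - expi theta separates even from odd indices.
   The block Jacobi inverse is a global linear inverse, so the block diagonal part has
   to be invertible on all grid vectors: spatial Fourier inversion reduces this
   to the invertibility of K + c M for c >= 0.  If f is in the kernel of K + c M, testing
   with f gives (f(tau)^2 + f(0)^2)/2 + c |f|^2 = 0, which settles c > 0; for
   c = 0, testing with f' gives |f'|^2 = 0, so f is constant and vanishes at 0. *)

Set Implicit Arguments.
Unset Strict Implicit.
Unset Printing Implicit Defensive.

Import Order.TTheory GRing.Theory Num.Theory.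
Import numFieldNormedType.Exports.

Local Open Scope classical_set_scope.
Local Open Scope ring_scope.
Local Open Scope complex_scope.

(** * Two facts of linear algebra *)

Lemma ker_col0_unitmx (F : fieldType) n (A : 'M[F]_n) :
  (forall x : 'cV_n, A *m x = 0 -> x = 0) -> A \in unitmx.
Proof.
move=> kerA; rewrite -unitmx_tr -row_free_unit; apply: inj_row_free => v vA.
by apply: trmx_inj; rewrite trmx0; apply: kerA; rewrite -[A]trmxK -trmx_mul vA trmx0.
Qed.

(** Linearity is a hypothesis on a bare function, so that [system], [restriction] and [mode] need no
    declared linear structure. *)
Lemma sum_of_linear (K : nzRingType) (V W : lmodType K) (f : V -> W) :
  linear f -> forall I (r : seq I) P (F : I -> V),
  f (\sum_(j <- r | P j) F j) = \sum_(j <- r | P j) f (F j).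
Proof.
move=> lf I r P F; apply: big_morph => [u v|].
  by have := lf 1 u v; rewrite !scale1r.
(* The scalar -1 at the zero vector gives f 0 = - f 0 + f 0 = 0. *)
by have := lf (-1) 0 0; rewrite !scaleN1r oppr0 addr0 addNr.
Qed.

(** * Integrals of polynomials over [0, a] *)

Section PolyIntegral.
Context {R : realType}.
Implicit Types (a : R) (f g q : {poly R}).
Local Notation mu := (@lebesgue_measure R).

Definition poly_int a q : R := \int[mu]_(t in `[0, a]) q.[t].

Lemma integrable_horner a q : mu.-integrable `[0, a] (EFin \o horner q).
Proof.
apply: continuous_compact_integrable; first exact: segment_compact.
by apply: continuous_subspaceT => x; exact: continuous_horner.
Qed.

Lemma poly_int_is_linear a : linear (poly_int a : {poly R} -> R^o).
Proof.
move=> c f g; rewrite /poly_int.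
under eq_Rintegral do rewrite hornerD hornerZ.
rewrite RintegralD //; last exact: integrable_horner.
  by rewrite RintegralZl //; exact: integrable_horner.
rewrite (_ : _ \o _ = EFin \o horner (c *: f)); first exact: integrable_horner.
by apply/funext => t /=; rewrite hornerZ.
Qed.

HB.instance Definition _ a := GRing.isLinear.Build R {poly R} R^o _
  (poly_int a : {poly R} -> R^o) (poly_int_is_linear a).

Lemma poly_intM a f g :
  \int[mu]_(t in `[0, a]) (f.[t] * g.[t]) = poly_int a (f * g).
Proof. by apply: eq_Rintegral => t _; rewrite hornerM. Qed.

Lemma poly_int_deriv a q : 0 < a -> poly_int a q^`() = q.[a] - q.[0].
Proof.
move=> a0; rewrite /poly_int /Rintegral.
rewrite (@continuous_FTC2 _ (horner q^`()) (horner q)) //.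
- by apply: continuous_subspaceT => x; exact: continuous_horner.
- split=> [x _||]; first exact: derivable_horner.
    exact/cvg_at_right_filter/continuous_horner.
  exact/cvg_at_left_filter/continuous_horner.
- by move=> x _; rewrite derivE.
Qed.

Lemma exists_poly_primitive q : exists Q : {poly R}, Q^`() = q.
Proof.
(* At i = 0 the coefficient is a division by 0, hence 0; differentiation discards it in any case. *)
exists (\poly_(i < (size q).+1) (q`_i.-1 / i%:R)); apply/polyP => i.
rewrite coef_deriv coef_poly ltnS; case: ltnP => [_|sq].
  by rewrite -[LHS]mulr_natr mulfVK ?pnatr_eq0.
by rewrite mul0rn nth_default.
Qed.

(** A primitive Q of f^2 is nondecreasing on [0, a] with equal end values, hence constant there; a
    polynomial that is constant on an interval is constant, so f^2 = Q' = 0. *)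
Lemma poly_int_sqr_eq0 a f : 0 < a -> poly_int a (f ^+ 2) = 0 -> f = 0.
Proof.
move=> a0; have [Q dQ] := exists_poly_primitive (f ^+ 2).
rewrite -dQ poly_int_deriv // => /eqP; rewrite subr_eq0 => /eqP Qa.
have Qmono x y : 0 <= x -> x <= y -> y <= a -> Q.[x] <= Q.[y].
  apply: ger0_derive1_ndecr => [z _|z _|]; first exact: derivable_horner.
    by rewrite -derivE dQ horner_exp sqr_ge0.
  by apply: continuous_subspaceT => z; exact: continuous_horner.
have Qcst : Q = (Q.[0])%:P.
  apply/eqP; rewrite -subr_eq0; set P := Q - _.
  (* These are [size P] distinct points of (0, a], more than the degree of a nonzero P allows as
     roots. *)
  pose s := [seq a / n.+1%:R | n <- iota 0 (size P)].
  apply/eqP/(@roots_geq_poly_eq0 _ _ s); last by rewrite size_map size_iota.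
    apply/allP => _ /mapP[n _ ->]; rewrite rootE /P hornerD hornerN hornerC.
    have n0 : (0 : R) < n.+1%:R by rewrite ltr0n.
    have x0 : 0 <= a / n.+1%:R by rewrite divr_ge0 // ltW.
    have xa : a / n.+1%:R <= a by rewrite ler_pdivrMr // ler_peMr ?ler1n // ltW.
    by rewrite subr_eq0 eq_le -{1}Qa !Qmono.
  rewrite map_inj_uniq ?iota_uniq // => m n /(mulfI (lt0r_neq0 a0)) /invr_inj.
  by move/eqP; rewrite eqr_nat => /eqP[].
by apply/eqP; rewrite -sqrf_eq0 -dQ Qcst derivC.
Qed.

End PolyIntegral.

(** * Invertibility of K + c M for c >= 0 *)

Section TimeMatrices.
Context {R : realType} {p : nat}.
Implicit Types (a c : R) (psi : p.+1.-tuple {poly_p.+1 R}).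
Implicit Types f g : {poly R}.

(* The bilinear form represented by Ktau + c Mtau. *)
Definition dg_form a c f g : R :=
  f.[a] * g.[a] - poly_int a (f * g^`()) + c * poly_int a (f * g).

Lemma dg_form_eq0 a c f : 0 < a -> 0 <= c ->
  dg_form a c f f = 0 -> dg_form a c f f^`() = 0 -> f = 0.
Proof.
move=> a0 c0 ff0 fdf0.
have Isqr g : 0 <= poly_int a (g ^+ 2).
  by apply: Rintegral_ge0 => t _; rewrite horner_exp sqr_ge0.
have parts g : poly_int a (g * g^`()) = 2^-1 * (g.[a] ^+ 2 - g.[0] ^+ 2).
  have := poly_int_deriv (g ^+ 2) a0.
  by rewrite expr2 derivM (mulrC g^`()) raddfD /= !hornerM -!expr2; lra.
(* The hypothesis becomes (f(a)^2 + f(0)^2)/2 + c * int f^2 = 0, a sum of nonnegative terms, so each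
   of them vanishes. *)
move: (ff0); rewrite /dg_form parts -expr2 => ff0'.
have cI := mulr_ge0 c0 (Isqr f).
have fa0 : f.[a] = 0 by nra.
have f00 : f.[0] = 0 by nra.
have cI0 : c * poly_int a (f ^+ 2) = 0 by nra.
move/eqP: cI0; rewrite mulf_eq0 => /orP[/eqP cz|/eqP]; last exact: poly_int_sqr_eq0.
(* With c = 0 and f(a) = 0, testing with f' leaves int f f'' = 0; integrating (f f')' then gives int
   f'^2 = 0. *)
move: fdf0; rewrite /dg_form cz fa0 !mul0r add0r addr0 => /eqP.
rewrite oppr_eq0 => /eqP I0.
have df0 : f^`() = 0.
  apply: (poly_int_sqr_eq0 a0).
  have := poly_int_deriv (f * f^`()) a0.
  by rewrite derivM raddfD /= I0 !hornerM fa0 f00 !mul0r addr0 subrr -expr2.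
have /size1_polyC fE : (size f <= 1)%N.
  by rewrite -subn_eq0 subn1 -size_deriv ?df0 ?size_poly0 //.
by move: f00; rewrite fE hornerC => ->.
Qed.

Lemma dg_form_comb a c f psi (y : 'I_p.+1 -> R) :
  dg_form a c f (\sum_k y k *: bfun psi k)
  = \sum_k y k * dg_form a c f (bfun psi k).
Proof.
rewrite /dg_form horner_sum raddf_sum /= !mulr_sumr !raddf_sum /= mulr_sumr.
rewrite -!big_split /=; apply: eq_bigr => k _.
by rewrite derivZ hornerZ -!scalerAr !linearZ /= /GRing.scale /=; ring.
Qed.

(** Columns carry the trial functions and rows the test functions, so a kernel vector is a trial
    polynomial annihilated by every basis test function. *)
Lemma Ktau_Mtau_mul a c psi (x : 'cV_p.+1) k :
  ((Ktau a psi + c *: Mtau a psi) *m x) k 0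
  = dg_form a c (\sum_l x l 0 *: bfun psi l) (bfun psi k).
Proof.
rewrite mxE /dg_form horner_sum !mulr_suml !raddf_sum /= mulr_sumr.
rewrite -!big_split /=; apply: eq_bigr => l _.
by rewrite !mxE -!scalerAl !linearZ /= /GRing.scale /= hornerZ !poly_intM; ring.
Qed.

Lemma Ktau_Mtau_unitmx a c psi : 0 < a -> 0 <= c -> is_poly_basis psi ->
  Ktau a psi + c *: Mtau a psi \in unitmx.
Proof.
move=> a0 c0 psiB; apply: ker_col0_unitmx => x Ax0.
pose f := \sum_l x l 0 *: tnth psi l.
have fE : val f = \sum_l x l 0 *: bfun psi l.
  by rewrite raddf_sum; apply: eq_bigr.
have span (g : {poly R}) : (size g <= p.+1)%N -> exists y, g = \sum_k y k *: bfun psi k.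
  move=> sg; exists (coord psi ^~ (npolyp p.+1 g)).
  rewrite -[LHS](npolypK sg) {1}(coord_basis psiB (memvf (npolyp p.+1 g))).
  rewrite raddf_sum.
  by apply: eq_bigr => k _; rewrite -tnth_nth.
(* Orthogonality to the basis extends to its span, which contains both f and f'. *)
have orth g : (size g <= p.+1)%N -> dg_form a c (val f) g = 0.
  move=> /span[y ->]; rewrite dg_form_comb big1 // => k _.
  by rewrite fE -Ktau_Mtau_mul Ax0 mxE mulr0.
have f0 : f = 0.
  apply/val_inj/(dg_form_eq0 a0 c0); apply: orth; first exact: size_npoly.
  by rewrite size_deriv (leq_trans (leq_pred _)) ?size_npoly.
apply/colP => l; rewrite mxE.
move: l; apply: (freeP (basis_free psiB) (fun l => x l 0)).
by rewrite -[RHS]f0; apply: eq_bigr => k _; rewrite -tnth_nth.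
Qed.

End TimeMatrices.

(** * The exponential e^{ix} and roots of unity *)

Section Expi.
Context {R : realType}.
Implicit Types x y : R.

Lemma expi0 : expi 0 = 1 :> R[i].
Proof. by rewrite /expi cos0 sin0. Qed.

Lemma expiD x y : expi (x + y) = expi x * expi y.
Proof. by rewrite /expi cosD sinD; simpc; rewrite [sin x * _ + _]addrC. Qed.

Lemma expiN_mul x : expi (- x) * expi x = 1.
Proof. by rewrite -expiD addNr expi0. Qed.

Lemma expi_neq0 x : expi x != 0.
Proof. by apply/eqP => e; move/eqP: (expiN_mul x); rewrite e mulr0 eq_sym oner_eq0. Qed.

Lemma expiN x : expi (- x) = (expi x)^-1.
Proof. by rewrite -[LHS](mulfK (expi_neq0 x)) expiN_mul mul1r. Qed.

Lemma expiMn (n : nat) x : expi (n%:R * x) = expi x ^+ n.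
Proof.
elim: n => [|n IHn]; first by rewrite mul0r expi0.
by rewrite -natr1 mulrDl mul1r expiD IHn exprSr.
Qed.

Lemma expi2 x : expi (2 * x) = expi x ^+ 2.
Proof. exact: expiMn 2 x. Qed.

Lemma expiDV x : expi x + (expi x)^-1 = (2 * cos x)%:C.
Proof.
rewrite -expiN /expi cosN sinN; apply/eqP; rewrite eq_complex /=.
by rewrite subrr eqxx andbT mulr2n mulrDl mul1r.
Qed.

Lemma expi_pi2 : expi (2 * pi) = 1 :> R[i].
Proof. by rewrite expi2 /expi cospi sinpi expr2; simpc. Qed.

Lemma expi_gamma x : expi (gamma x) = - expi x.
Proof.
rewrite /gamma /sign; case: ifP => _.
  by rewrite mul1r /expi cosB sinB cospi sinpi; simpc.
by rewrite mulN1r opprK /expi cosD sinD cospi sinpi; simpc.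
Qed.

Lemma cos_gamma x : cos (gamma x) = - cos x.
Proof. by have [] := expi_gamma x. Qed.

Lemma expi_zpi2 (k : int) : expi (k%:~R * (2 * pi)) = 1 :> R[i].
Proof.
case: k => n; first by rewrite expiMn expi_pi2 expr1n.
by rewrite NegzE mulrNz mulNr expiN expiMn expi_pi2 expr1n invr1.
Qed.

Lemma prim_root_expi N : (0 < N)%N -> N.-primitive_root (expi (2 * pi / N%:R : R)).
Proof.
move=> N0; have NR : (N%:R : R) != 0 by rewrite pnatr_eq0 -lt0n.
have NR0 : (0 : R) < N%:R by rewrite ltr0n.
rewrite /primitive_root_of_unity N0; apply/forallP => i.
rewrite unity_rootE -expiMn; apply/eqP; case: (i.+1 =P N) => [->|/eqP iN].
  by rewrite mulrCA divff // mulr1 expi_pi2 eqxx.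
have {iN} iN : (i.+1 < N)%N by rewrite ltn_neqAle iN ltn_ord.
apply/negbTE/eqP => /eqP; rewrite eq_complex => /andP[/eqP /= e _].
(* The half angle y lies in (0, pi), so sin y > 0 and the real part cos (2y) = 1 - 2 sin^2 y is
   below 1. *)
pose y : R := i.+1%:R * (pi / N%:R).
have y0 : 0 < sin y.
  apply: sin_gt0_pi; rewrite mulr_gt0 ?divr_gt0 ?ltr0n ?pi_gt0 //=.
  rewrite /y mulrCA -[X in _ < X]mulr1 ltr_pM2l ?pi_gt0 //.
  by rewrite ltr_pdivrMr // mul1r ltr_nat.
move: e; have -> : i.+1%:R * (2 * pi / N%:R) = y + y by rewrite /y; ring.
rewrite cosD => e; have := cos2Dsin2 y; rewrite !expr2 => e2; nra.
Qed.

End Expi.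

(** * Sums over residue classes *)

Section CyclicSums.
Context {F : fieldType}.
Implicit Types (z : F) (m N : nat).

Lemma sum_residue z m N : (0 < N)%N -> z ^+ N = 1 ->
  \sum_(s < N) (s == m %[mod N])%:R * z ^+ s = z ^+ m.
Proof.
move=> N0 zN; rewrite (bigD1 (Ordinal (ltn_pmod m N0))) //= modn_mod eqxx mul1r.
rewrite expr_mod // big1 ?addr0 // => s sm; rewrite [(s %% N)%N]modn_small //.
by case: eqP => [e|]; rewrite ?mul0r //; case/negP: sm; apply/eqP/val_inj.
Qed.

Lemma double_eqmod a b N :
  (a.*2 == b.*2 %[mod N.*2]) = (a == b %[mod N]).
Proof. by rewrite -!muln2 -!muln_modl eqn_pmul2r. Qed.

(** As N is even, congruence modulo N preserves parity: an odd m meets no coarse index, and an even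
    m meets exactly the class of m/2 modulo N/2. *)
Lemma sum_double_residue z m N : (0 < N)%N -> ~~ odd N -> z ^+ N = 1 ->
  \sum_(n < N./2) (m == n.*2 %[mod N])%:R * z ^+ n.*2 = (~~ odd m)%:R * z ^+ m.
Proof.
move=> N0 Neven zN; have NE := even_halfK Neven.
have N20 : (0 < N./2)%N by rewrite half_gt0 -NE; case: N./2 NE N0 => // <-.
have [om|em] := boolP (odd m).
  rewrite mul0r big1 // => n _; case: eqP => [/(congr1 odd)|]; last by rewrite mul0r.
  by rewrite !odd_mod ?(negbTE Neven) // odd_double om.
rewrite mul1r -[in RHS](even_halfK em) -mul2n exprM -(sum_residue _ N20); last first.
  by rewrite -exprM mul2n NE.
apply: eq_bigr => n _.
by rewrite -exprM mul2n -(double_eqmod n) NE even_halfK // eq_sym.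
Qed.

(** The backward shift is written as adding N - 1, because n - 1 is truncated at n = 0. *)
Lemma eq_mod_succ m n N : (0 < N)%N ->
  (m.+1 == n %[mod N]) = (m == n + N.-1 %[mod N]).
Proof.
move=> N0; rewrite -(eqn_modDr 1 m) !addn1 -addnS prednK //.
by rewrite modnDr.
Qed.

Lemma expr_pred z N : (0 < N)%N -> z ^+ N = 1 -> z ^+ N.-1 = z^-1.
Proof.
case: N => // N _ zN; have z0 : z != 0.
  by apply/eqP => e; move/eqP: zN; rewrite e expr0n /= eq_sym oner_eq0.
by apply: (mulIf z0); rewrite -exprSr zN mulVf.
Qed.

End CyclicSums.

(** * Fourier modes and linearity of the grid operators *)

Section Modes.
Context {R : realType} {p Nt Nx : nat}.
Implicit Types (theta : R * R) (w : 'cV[R[i]]_p.+1) (u v : gridvec R p Nt Nx).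
Implicit Types (tau h omega : R) (psi psit : p.+1.-tuple {poly_p.+1 R}).

Lemma gridvec_combE (c : R[i]) u v i : (c *: u + v) i = c *: u i + v i.
Proof. by rewrite !ffunE. Qed.

(** The amplitude may vary arbitrarily in time: the block diagonal part does not couple time steps,
    so a Fourier expansion in space suffices to invert it. *)
Definition space_mode (thetax : R) (w : 'I_Nt -> 'cV[R[i]]_p.+1) :
    gridvec R p Nt Nx :=
  [ffun i : 'I_Nt * 'I_Nx => expi thetax ^+ i.2 *: w i.1].

Definition mode theta w : gridvec R p Nt Nx :=
  space_mode theta.1 (fun n : 'I_Nt => expi theta.2 ^+ n *: w).

Lemma modeE theta w i :
  mode theta w i = (expi theta.2 ^+ i.1 * expi theta.1 ^+ i.2) *: w.
Proof. by rewrite ffunE scalerA mulrC. Qed.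

(** This is aliasing: frequencies with the same exponentials give the same grid mode. *)
Lemma eq_mode theta theta' : expi theta.1 = expi theta'.1 ->
  expi theta.2 = expi theta'.2 -> mode theta = mode theta'.
Proof. by rewrite /mode /space_mode => -> ->. Qed.

Lemma mode_is_linear theta : linear (mode theta).
Proof.
move=> c v w; apply/ffunP => i; rewrite gridvec_combE !modeE scalerDr !scalerA.
by rewrite [c * _]mulrC.
Qed.

Lemma modeBZ theta (c : R[i]) (v w : 'cV[R[i]]_p.+1) :
  mode theta (v - c *: w) = mode theta v - c *: mode theta w.
Proof.
rewrite -!scaleNr ![_ + - c *: _]addrC.
exact: mode_is_linear.
Qed.

Lemma harmvecE (thetax thetat : R) U :
  harmvec thetax thetat U
  = \sum_(j < 4) mode (tnth (harmfreq thetax thetat) j) (U j *m const_mx 1).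
Proof.
apply/ffunP => i; rewrite ffunE sum_ffunE; apply: eq_bigr => j _.
by rewrite modeE /Phi !expiMn -scalemxAr.
Qed.

Lemma Mh_is_linear h : linear (Mh h : gridvec R p Nt Nx -> gridvec R p Nt Nx).
Proof.
move=> c u v; apply/ffunP => -[n r]; rewrite !ffunE /=.
move: (u _) (u _) (u _) (v _) (v _) (v _) => x1 x2 x3 y1 y2 y3.
by apply/matrixP => a b; rewrite !mxE; ring.
Qed.

Lemma Kh_is_linear h : linear (Kh h : gridvec R p Nt Nx -> gridvec R p Nt Nx).
Proof.
move=> c u v; apply/ffunP => -[n r]; rewrite !ffunE /=.
move: (u _) (u _) (u _) (v _) (v _) (v _) => x1 x2 x3 y1 y2 y3.
by apply/matrixP => a b; rewrite !mxE; ring.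
Qed.

Lemma blockdiagE tau h psi u i :
  blockdiag tau h psi u i
  = cmx (Ktau tau psi) *m Mh h u i + cmx (Mtau tau psi) *m Kh h u i.
Proof. by rewrite ffunE. Qed.

Lemma blockdiag_is_linear tau h psi :
  linear (blockdiag tau h psi : gridvec R p Nt Nx -> gridvec R p Nt Nx).
Proof.
move=> c u v; apply/ffunP => i.
rewrite [RHS]gridvec_combE [LHS]blockdiagE (blockdiagE tau h psi u).
rewrite (blockdiagE tau h psi v).
rewrite (Mh_is_linear h c u v) (Kh_is_linear h c u v) !gridvec_combE.
by rewrite !mulmxDr -!scalemxAr scalerDr addrACA.
Qed.

HB.instance Definition _ tau h psi :=
  GRing.isLinear.Build R[i] (gridvec R p Nt Nx) (gridvec R p Nt Nx) _
    (blockdiag tau h psi : gridvec R p Nt Nx -> gridvec R p Nt Nx)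
    (blockdiag_is_linear tau h psi).

Lemma systemE tau h psi u i :
  system tau h psi u i
  = blockdiag tau h psi u i - cmx (Ntau tau psi) *m Mh h u (ord_pred i.1, i.2).
Proof. by rewrite ffunE blockdiagE. Qed.

Lemma system_is_linear tau h psi :
  linear (system tau h psi : gridvec R p Nt Nx -> gridvec R p Nt Nx).
Proof.
move=> c u v; apply/ffunP => i.
rewrite [RHS]gridvec_combE [LHS]systemE (systemE tau h psi u).
rewrite (systemE tau h psi v).
rewrite (blockdiag_is_linear tau h psi c u v) (Mh_is_linear h c u v).
by rewrite !gridvec_combE mulmxDr -scalemxAr opprD addrACA scalerBr.
Qed.

End Modes.

(** * Symbols of the mass, stiffness, block diagonal and system operators *)

Section ModeAction.
Context {R : realType} {p Nt Nx : nat}.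
Implicit Types (theta : R * R) (w : 'cV[R[i]]_p.+1) (u v : gridvec R p Nt Nx).
Implicit Types (tau h omega : R) (psi psit : p.+1.-tuple {poly_p.+1 R}).

Lemma expr_ord_pred (F : fieldType) (z : F) N (j : 'I_N) :
  z ^+ N = 1 -> z ^+ ord_pred j = z^-1 * z ^+ j.
Proof.
move=> zN; have N0 : (0 < N)%N by apply: leq_ltn_trans (ltn_ord j).
rewrite /= expr_mod // -(expr_pred N0 zN) -exprD; congr (z ^+ _).
by move: N0; clear; lia.
Qed.

Lemma expr_ordS (F : fieldType) (z : F) N (j : 'I_N) :
  z ^+ N = 1 -> z ^+ ordS j = z * z ^+ j.
Proof. by move=> zN; rewrite /= expr_mod // exprS. Qed.

Lemma cos2_gt0 (x : R) : 0 < 2 + cos x.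
Proof. by have := cos_geN1 x; lra. Qed.

Lemma Mh_space_mode h (x : R) (w : 'I_Nt -> 'cV[R[i]]_p.+1) : expi x ^+ Nx = 1 ->
  Mh h (space_mode x w : gridvec R p Nt Nx)
  = space_mode x (fun n => (h / 3 * (2 + cos x))%:C *: w n).
Proof.
move=> xN; apply/ffunP => i; rewrite !ffunE /=.
rewrite (expr_ord_pred _ xN) (expr_ordS _ xN) !scalerA -!scalerDl scalerA.
congr (_ *: _); set z := expi x.
rewrite -[_ *: _]/(_ * _).
have -> : z^-1 + 4 + z = 4 + (z + z^-1) by ring.
by rewrite expiDV !rmorphM rmorphD !fmorphV /= !rmorph_nat; field.
Qed.

Lemma Kh_space_mode h (x : R) (w : 'I_Nt -> 'cV[R[i]]_p.+1) : expi x ^+ Nx = 1 ->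
  Kh h (space_mode x w : gridvec R p Nt Nx)
  = space_mode x (fun n => (h^-1 * (2 - 2 * cos x))%:C *: w n).
Proof.
move=> xN; apply/ffunP => i; rewrite !ffunE /=.
rewrite (expr_ord_pred _ xN) (expr_ordS _ xN) !scalerA -!scaleNr -!scalerDl scalerA.
congr (_ *: _); set z := expi x.
rewrite -[_ *: _]/(_ * _).
have -> : - z^-1 + 2 - z = 2 - (z + z^-1) by ring.
by rewrite expiDV -[_ *: cos x]/(_ * _) ; ring.
Qed.

Definition Ahat tau h psi (x : R) : 'M[R[i]]_p.+1 :=
  cmx (Ktau tau psi) + (h ^- 2 * beta x)%:C *: cmx (Mtau tau psi).

(** The symbol of the block diagonal part; the scalar in front is the symbol of [Mh], and [beta]
    divided by h^2 is the quotient of the symbols of [Kh] and [Mh]. *)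
Definition Dhat tau h psi (x : R) : 'M[R[i]]_p.+1 :=
  (h / 3 * (2 + cos x))%:C *: Ahat tau h psi x.

Lemma blockdiag_space_mode tau h psi x (w : 'I_Nt -> 'cV[R[i]]_p.+1) :
   0 < h -> expi x ^+ Nx = 1 ->
  blockdiag tau h psi (space_mode x w : gridvec R p Nt Nx)
  = space_mode x (fun n => Dhat tau h psi x *m w n).
Proof.
move=> h0 xN; apply/ffunP => i.
rewrite blockdiagE Mh_space_mode // Kh_space_mode // !ffunE -!scalemxAr -scalerDr.
congr (_ *: _); rewrite /Dhat -scalemxAl mulmxDl scalerDr; congr (_ + _).
rewrite -scalemxAl scalerA -rmorphM; congr (_%:C *: _); rewrite /beta.
by field; rewrite !gt_eqF ?cos2_gt0.
Qed.

Lemma blockdiag_mode tau h psi theta w : 0 < h -> expi theta.1 ^+ Nx = 1 ->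
  blockdiag tau h psi (mode theta w : gridvec R p Nt Nx)
  = mode theta (Dhat tau h psi theta.1 *m w).
Proof.
move=> h0 xN; rewrite blockdiag_space_mode //; apply/ffunP => i.
by rewrite !ffunE -scalemxAr.
Qed.

Lemma LhatE tau h psi theta :
  Lhat tau h psi theta = Dhat tau h psi theta.1
  - (h / 3 * (2 + cos theta.1))%:C *: (expi (- theta.2) *: cmx (Ntau tau psi)).
Proof. by rewrite /Lhat scalerBr. Qed.

Lemma system_mode tau h psi theta w : 0 < h ->
  expi theta.1 ^+ Nx = 1 -> expi theta.2 ^+ Nt = 1 ->
  system tau h psi (mode theta w : gridvec R p Nt Nx)
  = mode theta (Lhat tau h psi theta *m w).
Proof.
move=> h0 xN tN; apply/ffunP => i.
rewrite systemE blockdiag_mode // Mh_space_mode // LhatE mulmxBl.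
rewrite -(scalemxAl _ (expi (- theta.2) *: _)) modeBZ.
rewrite [RHS]ffunE [X in _ = _ + X]ffunE; congr (_ - _).
rewrite !ffunE (expr_ord_pred _ tN) expiN -!scalemxAr -!scalemxAl !scalerA.
by congr (_ *: _); ring.
Qed.

(** The weight [h ^- 2 * beta x] is nonnegative, so the real matrix is invertible, and its
    complexification remains so. *)
Lemma Ahat_unitmx tau h psi x : 0 < tau -> is_poly_basis psi ->
  Ahat tau h psi x \in unitmx.
Proof.
move=> tau0 psiB; have <- : cmx (Ktau tau psi + (h ^- 2 * beta x) *: Mtau tau psi)
    = Ahat tau h psi x.
  by rewrite /cmx map_mxD map_mxZ.
rewrite map_unitmx Ktau_Mtau_unitmx //.
rewrite mulr_ge0 ?invr_ge0 ?exprn_even_ge0 //.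
by rewrite /beta mulr_ge0 // divr_ge0 ?subr_ge0 ?cos_le1 // ltW // cos2_gt0.
Qed.

Lemma Dhat_scale_neq0 h (x : R) : 0 < h -> (h / 3 * (2 + cos x))%:C != 0.
Proof. by move=> h0; rewrite fmorph_eq0 !mulf_neq0 ?invr_eq0 ?gt_eqF ?cos2_gt0. Qed.

Lemma Dhat_unitmx tau h psi x : 0 < tau -> 0 < h -> is_poly_basis psi ->
  Dhat tau h psi x \in unitmx.
Proof.
move=> tau0 h0 psiB; rewrite unitmxZ ?Ahat_unitmx //.
by rewrite unitfE Dhat_scale_neq0.
Qed.

End ModeAction.

(** * Discrete Fourier inversion *)

Section Fourier.
Context {F : fieldType} {V : lmodType F}.

Lemma prim_root_orthogonal N (z : F) (r s : 'I_N) : N.-primitive_root z ->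
  \sum_(k < N) (z ^+ k) ^+ r / (z ^+ k) ^+ s = N%:R * (r == s)%:R.
Proof.
move=> zP; have zN := prim_expr_order zP; have N0 := prim_order_gt0 zP.
have z0 : z != 0.
  by apply: contra_eq_neq zN => ->; rewrite expr0n gtn_eqF // eq_sym oner_eq0.
(* The sum is geometric with ratio x, where x^N = 1; x = 1 exactly when r = s, and otherwise
   multiplying by x - 1 shows that it vanishes. *)
pose x := z ^+ r / z ^+ s.
have xk k : (z ^+ k) ^+ r / (z ^+ k) ^+ s = x ^+ k.
  by rewrite /x expr_div_n -!exprM ![(k * _)%N]mulnC.
under eq_bigr do rewrite xk.
have [rs|rs] := eqVneq r s.
  rewrite mulr1 (_ : x = 1) ?divff ?expf_neq0 //.
    by under eq_bigr do rewrite expr1n; rewrite sumr_const card_ord.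
  by rewrite /x rs divff ?expf_neq0.
have x1 : x - 1 != 0.
  rewrite subr_eq0; apply: contraNneq rs => e; apply/eqP/val_inj/eqP => /=.
  have /eqP : z ^+ r = z ^+ s by rewrite -[RHS]mul1r -e mulfVK ?expf_neq0.
  by rewrite (eq_prim_root_expr zP) !modn_small.
apply: (mulfI x1); rewrite -subrX1 mulr0 mulr0.
by rewrite /x expr_div_n -!exprM ![(_ * N)%N]mulnC !exprM zN !expr1n divr1 subrr.
Qed.

Lemma prim_root_inversion N (z : F) (g : 'I_N -> V) (r : 'I_N) :
  N.-primitive_root z -> N%:R != 0 :> F ->
  \sum_(k < N) (z ^+ k) ^+ r *:
    (N%:R^-1 *: \sum_(s < N) (z ^+ k) ^- s *: g s) = g r.
Proof.
move=> zP NR.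
transitivity (\sum_(s < N) (N%:R^-1 * (N%:R * (r == s)%:R)) *: g s).
  under eq_bigr do rewrite scalerA scaler_sumr.
  rewrite exchange_big; apply: eq_bigr => s _.
  rewrite -(prim_root_orthogonal _ _ zP) mulr_sumr scaler_suml.
  by apply: eq_bigr => k _; rewrite scalerA mulrAC mulrC.
rewrite (bigD1 r) //= eqxx mulr1 mulVf // scale1r big1 ?addr0 // => s sr.
by rewrite eq_sym (negbTE sr) !mulr0 scale0r.
Qed.

End Fourier.

(** * The global inverse of the block diagonal part *)

Section BlockInverse.
Context {R : realType} {p Nt Nx : nat}.
Implicit Types (theta : R * R) (w : 'cV[R[i]]_p.+1) (u v : gridvec R p Nt Nx).
Implicit Types (tau h omega : R) (psi psit : p.+1.-tuple {poly_p.+1 R}).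

(* Spatial Fourier inversion writes every grid vector as a sum of modes on which
   the block diagonal part acts by the invertible matrices Dhat. *)
Lemma blockdiag_surj tau h psi u :
  (0 < Nx)%N -> 0 < tau -> 0 < h -> is_poly_basis psi ->
  exists v, blockdiag tau h psi v = u.
Proof.
move=> Nx0 tau0 h0 psiB.
have xP := @prim_root_expi R _ Nx0; set x := 2 * pi / Nx%:R in xP.
pose c (k : 'I_Nx) (n : 'I_Nt) : 'cV[R[i]]_p.+1 :=
  Nx%:R^-1 *: \sum_(s < Nx) (expi x ^+ k) ^- s *: u (n, s).
exists (\sum_(k < Nx) space_mode (k%:R * x)
  (fun n => invmx (Dhat tau h psi (k%:R * x)) *m c k n)).
rewrite (sum_of_linear (blockdiag_is_linear tau h psi)).
apply/ffunP => -[n r].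
rewrite sum_ffunE.
rewrite -[RHS](prim_root_inversion (fun s => u (n, s)) _ xP) ?pnatr_eq0 -?lt0n //.
apply: eq_bigr => k _; rewrite blockdiag_space_mode //; last first.
  by rewrite expiMn -exprM mulnC exprM (prim_expr_order xP) expr1n.
by rewrite ffunE (mulKVmx (Dhat_unitmx _ tau0 h0 psiB)) (expiMn k x).
Qed.

(** Surjectivity and the rank-nullity formula make the kernel trivial, so the linear inverse in
    [blockdiag_inv] is a genuine left inverse. *)
Lemma blockdiagK tau h psi :
  (0 < Nx)%N -> 0 < tau -> 0 < h -> is_poly_basis psi ->
  cancel (blockdiag tau h psi : gridvec R p Nt Nx -> gridvec R p Nt Nx)
    (blockdiag_inv tau h psi).
Proof.
move=> Nx0 tau0 h0 psiB u; pose D := linfun (blockdiag tau h psi :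
  gridvec R p Nt Nx -> gridvec R p Nt Nx).
have DE : D =1 blockdiag tau h psi by move=> v; rewrite lfunE.
rewrite /blockdiag_inv -/D -DE lker0_lfunK //.
have full : limg D = fullv.
  apply/eqP; rewrite eqEsubv subvf /=; apply/subvP => v _.
  have [w <-] := blockdiag_surj v Nx0 tau0 h0 psiB.
  by rewrite -DE memv_img ?memvf.
have /eqP := limg_ker_dim D fullv.
by rewrite full capfv -[X in _ == X]add0n eqn_add2r dimv_eq0.
Qed.

Lemma blockdiag_inv_mode tau h psi theta w :
  (0 < Nx)%N -> 0 < tau -> 0 < h -> is_poly_basis psi -> expi theta.1 ^+ Nx = 1 ->
  blockdiag_inv tau h psi (mode theta w : gridvec R p Nt Nx)
  = mode theta (invmx (Dhat tau h psi theta.1) *m w).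
Proof.
move=> Nx0 tau0 h0 psiB xN.
rewrite -{1}(mulKVmx (Dhat_unitmx theta.1 tau0 h0 psiB) w) -blockdiag_mode //.
exact: blockdiagK.
Qed.

End BlockInverse.

(** * Restriction and prolongation of modes *)

Lemma odd_addn_pred m N : (0 < N)%N -> ~~ odd N -> odd (m + N.-1) = ~~ odd m.
Proof. by case: N => //= N _; rewrite negbK oddD => ->; rewrite addbT. Qed.

Section TransferModes.
Context {R : realType} {p Nt Nx : nat}.
Implicit Types (theta : R * R) (w : 'cV[R[i]]_p.+1).
Implicit Types (tau : R) (psi psit : p.+1.-tuple {poly_p.+1 R}).

Lemma RspaceC (r : 'I_Nx./2) (q : 'I_Nx) :
  (Rspace r q : R)%:C = 2^-1 * ((q.+1 == r.*2 %[mod Nx])%:R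
    + 2 * (q == r.*2 %[mod Nx])%:R + (q == r.*2.+1 %[mod Nx])%:R).
Proof.
by rewrite mxE !(rmorphM, rmorphD, fmorphV) /= !rmorph_nat.
Qed.

Lemma RtimeC tau psi psit (n : 'I_Nt./2) (s : 'I_Nt) : (0 < Nt)%N ->
  cmx (Rtime tau psi psit n s)
  = (s == n.*2 + Nt.-1 %[mod Nt])%:R *: cmx (R1 tau psi psit)
    + (s == n.*2 %[mod Nt])%:R *: cmx (R2 tau psi psit).
Proof.
by move=> Nt0; rewrite /Rtime eq_mod_succ // /cmx map_mxD !map_mxZ !rmorph_nat.
Qed.

Lemma sum_Rspace (x : R) (r : 'I_Nx./2) : (0 < Nx)%N -> expi x ^+ Nx = 1 ->
  \sum_(q < Nx) (Rspace r q)%:C * expi x ^+ q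
  = (Rxhat x)%:C * expi (2 * x) ^+ r.
Proof.
move=> Nx0 xN; rewrite expi2 -exprM mul2n.
transitivity (2^-1 * (expi x ^+ (r.*2 + Nx.-1) + 2 * expi x ^+ r.*2
                      + expi x ^+ r.*2.+1)).
  rewrite -!(sum_residue _ Nx0 xN) mulr_sumr -!big_split mulr_sumr /=.
  by apply: eq_bigr => q _; rewrite RspaceC eq_mod_succ //; ring.
rewrite exprD (expr_pred Nx0 xN) exprS.
have -> : expi x ^+ r.*2 / expi x + 2 * expi x ^+ r.*2 + expi x * expi x ^+ r.*2
  = (2 + (expi x + (expi x)^-1)) * expi x ^+ r.*2 by ring.
by rewrite expiDV mulrA /Rxhat; congr (_ * _); field.
Qed.

Lemma sum_Rtime tau psi psit (t : R) (n : 'I_Nt./2) :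
  (0 < Nt)%N -> expi t ^+ Nt = 1 ->
  \sum_(s < Nt) expi t ^+ s *: cmx (Rtime tau psi psit n s)
  = expi (2 * t) ^+ n *:
      (expi (- t) *: cmx (R1 tau psi psit) + cmx (R2 tau psi psit)).
Proof.
move=> Nt0 tN; rewrite expi2 -exprM mul2n expiN scalerDr scalerA.
rewrite -(expr_pred Nt0 tN) -exprD -!(sum_residue _ Nt0 tN) !scaler_suml -big_split.
apply: eq_bigr => s _; rewrite RtimeC // scalerDr !scalerA.
by rewrite ![_%:R * _]mulrC.
Qed.

Lemma restriction_mode tau psi psit theta w : (0 < Nt)%N -> (0 < Nx)%N ->
  expi theta.1 ^+ Nx = 1 -> expi theta.2 ^+ Nt = 1 ->
  restriction tau psi psit (mode theta w : gridvec R p Nt Nx)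
  = mode (2 * theta.1, 2 * theta.2) (Rhat tau psi psit theta *m w).
Proof.
move=> Nt0 Nx0 xN tN; apply/ffunP => -[n r]; rewrite ffunE modeE /=.
transitivity ((\sum_(q < Nx) (Rspace r q)%:C * expi theta.1 ^+ q) *:
  ((\sum_(s < Nt) expi theta.2 ^+ s *: cmx (Rtime tau psi psit n s)) *m w)).
  rewrite mulmx_suml scaler_sumr; apply: eq_bigr => s _.
  rewrite scaler_suml; apply: eq_bigr => q _.
  rewrite modeE -scalemxAr -scalemxAl !scalerA; congr (_ *: _) => /=.
  by ring.
rewrite sum_Rspace // sum_Rtime // -!scalemxAl !scalerA.
by congr (_ *: _); ring.
Qed.

Lemma expr_expi_gamma (x : R) n :
  expi (gamma x) ^+ n = (if odd n then - expi x ^+ n else expi x ^+ n).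
Proof. by rewrite expi_gamma exprNn -signr_odd; case: odd; rewrite ?mulN1r ?mul1r. Qed.

(** An even q has one coarse neighbour of weight 1, an odd q two of weight 1/2, which yields the
    factors 1 and cos x. The two symbols reproduce them: passing to [gamma x] negates the cosine,
    and also the power when q is odd. *)
Lemma sum_Pspace (x : R) (q : 'I_Nx) :
  (0 < Nx)%N -> ~~ odd Nx -> expi x ^+ Nx = 1 ->
  \sum_(r < Nx./2) (Pspace q r)%:C * expi (2 * x) ^+ r
  = (Pxhat x)%:C * expi x ^+ q + (Pxhat (gamma x))%:C * expi (gamma x) ^+ q.
Proof.
move=> Nx0 Nxe xN; have x0 := expi_neq0 x.
transitivity (2^-1 * ((odd q)%:R * expi x ^+ q.+1 + 2 * ((~~ odd q)%:R * expi x ^+ q)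
   + (odd q)%:R * (expi x ^+ q / expi x))).
  have e1 := sum_double_residue q.+1 Nx0 Nxe xN.
  have e2 := sum_double_residue q Nx0 Nxe xN.
  have e3 := sum_double_residue (q + Nx.-1) Nx0 Nxe xN.
  rewrite /= negbK in e1.
  rewrite odd_addn_pred // negbK exprD (expr_pred Nx0 xN) in e3.
  rewrite -e1 -e2 -e3 mulr_sumr -!big_split mulr_sumr /=; apply: eq_bigr => r _.
  rewrite mxE RspaceC (eq_sym (q %% Nx)%N (r.*2.+1 %% Nx)%N) (eq_mod_succ _ q) //.
  rewrite [(r.*2 %% Nx)%N == _]eq_sym.
  by rewrite expi2 -exprM mul2n; ring.
rewrite expr_expi_gamma /Pxhat cos_gamma.
case: (odd q); last by rewrite /=; field.
transitivity (2^-1 * (expi x + (expi x)^-1) * expi x ^+ q).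
  by rewrite exprS /=; field.
by rewrite expiDV; field.
Qed.

(** Odd steps receive only [R1]^T and even steps only [R2]^T; the signs produced by [gamma t] cancel
    the other term on the right. *)
Lemma sum_Ptime tau psi psit (t : R) (s : 'I_Nt) :
  (0 < Nt)%N -> ~~ odd Nt -> expi t ^+ Nt = 1 ->
  \sum_(n < Nt./2) expi (2 * t) ^+ n *: cmx (Ptime tau psi psit s n)
  = expi t ^+ s *: (2^-1 *:
      (expi t *: cmx (R1 tau psi psit)^T + cmx (R2 tau psi psit)^T))
    + expi (gamma t) ^+ s *: (2^-1 *:
      (expi (gamma t) *: cmx (R1 tau psi psit)^T + cmx (R2 tau psi psit)^T)).
Proof.
move=> Nt0 Nte tN.
set A := cmx (R1 _ _ _)^T; set B := cmx (R2 _ _ _)^T.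
transitivity (((odd s)%:R * expi t ^+ s.+1) *: A + ((~~ odd s)%:R * expi t ^+ s) *: B).
  have e1 := sum_double_residue s.+1 Nt0 Nte tN.
  rewrite /= negbK in e1.
  rewrite -e1 -(sum_double_residue s Nt0 Nte tN) !scaler_suml -big_split /=.
  apply: eq_bigr => n _.
  have -> : cmx (Ptime tau psi psit s n)
      = (s.+1 == n.*2 %[mod Nt])%:R *: A + (s == n.*2 %[mod Nt])%:R *: B.
    by rewrite /Ptime /Rtime linearD !linearZ /cmx map_mxD !map_mxZ /= !rmorph_nat.
  by rewrite expi2 -exprM mul2n scalerDr !scalerA ![_%:R * _]mulrC.
clearbody A B.
rewrite (expr_expi_gamma t s) (expi_gamma t) exprS.
move: (expi t) (expi t ^+ s) => z y.
case: (odd s) => /=.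
all: apply/matrixP => k l.
all: rewrite !mxE.
all: by field.
Qed.

Lemma sum_harmfreq (V : nmodType) (G : R * R -> V) (thetax thetat : R) :
  \sum_(j < 4) G (tnth (harmfreq thetax thetat) j)
  = (G (thetax, thetat) + G (gamma thetax, thetat))
    + (G (thetax, gamma thetat) + G (gamma thetax, gamma thetat)).
Proof. by rewrite !big_ord_recl big_ord0 addr0 !addrA. Qed.

Lemma prolongation_mode tau psi psit (thetax thetat : R) w :
  (0 < Nt)%N -> ~~ odd Nt -> (0 < Nx)%N -> ~~ odd Nx ->
  expi thetax ^+ Nx = 1 -> expi thetat ^+ Nt = 1 ->
  prolongation tau psi psit
    (mode (2 * thetax, 2 * thetat) w : gridvec R p Nt./2 Nx./2)
  = \sum_(j < 4) mode (tnth (harmfreq thetax thetat) j)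
      (Phat tau psi psit (tnth (harmfreq thetax thetat) j) *m w)
    :> gridvec R p Nt Nx.
Proof.
move=> Nt0 Nte Nx0 Nxe xN tN; apply/ffunP => -[s q]; rewrite ffunE sum_ffunE /=.
transitivity ((\sum_(r < Nx./2) (Pspace q r)%:C * expi (2 * thetax) ^+ r) *:
  ((\sum_(n < Nt./2) expi (2 * thetat) ^+ n *: cmx (Ptime tau psi psit s n)) *m w)).
  rewrite mulmx_suml scaler_sumr; apply: eq_bigr => n _.
  rewrite scaler_suml; apply: eq_bigr => r _.
  rewrite modeE -scalemxAr -scalemxAl !scalerA; congr (_ *: _) => /=.
  by ring.
rewrite sum_Pspace // sum_Ptime //.
pose Pt t := 2^-1 *: (expi t *: cmx (R1 tau psi psit)^T + cmx (R2 tau psi psit)^T).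
pose G theta := ((Pxhat theta.1)%:C * expi theta.1 ^+ q)
                *: ((expi theta.2 ^+ s *: Pt theta.2) *m w).
transitivity (\sum_(j < 4) G (tnth (harmfreq thetax thetat) j)); last first.
  apply: eq_bigr => j _; rewrite modeE /Phat /G -!scalemxAl !scalerA.
  by congr (_ *: _); ring.
(* Two spatial terms times two temporal terms give the four harmonics, grouped as in
   [sum_harmfreq]. *)
have expand a b (A B : 'M[R[i]]_p.+1) : (a + b) *: ((A + B) *m w)
    = (a *: (A *m w) + b *: (A *m w)) + (a *: (B *m w) + b *: (B *m w)).
  by rewrite mulmxDl scalerDl !scalerDr addrACA.
by rewrite (sum_harmfreq G); exact: expand.
Qed.

End TransferModes.

(** * Algebra of the damped Jacobi symbol *)

Lemma damped_jacobi_mx (F : fieldType) n (A N : 'M[F]_n) (a e c : F) :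
  A \in unitmx -> a != 0 ->
  (1 - c)%:M + (c * e) *: (invmx A *m N)
  = 1%:M - c *: (invmx (a *: A) *m (a *: A - a *: (e *: N))).
Proof.
move=> Au a0; have aAu : a *: A \in unitmx by rewrite unitmxZ ?unitfE.
(* Factoring out a A, the symbol of the block diagonal part, lets its inverse cancel together with
   the scale a. *)
have -> : a *: A - a *: (e *: N) = a *: A *m (1%:M - e *: (invmx A *m N)).
  by rewrite mulmxBr mulmx1 -scalemxAr -!scalemxAl mulKVmx // !scalerA mulrC.
by rewrite mulKmx // scalerBr scalerA opprB addrCA addrC raddfB /= scalemx1.
Qed.

(** * Periodicity and aliasing of the harmonic frequencies *)

Section HarmonicFrequencies.
Context {R : realType}.
Implicit Types x thetax thetat : R.

Lemma Theta_expi Nx Nt (theta : R * R) : (0 < Nx)%N -> (0 < Nt)%N ->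
  Theta Nx Nt theta -> expi theta.1 ^+ Nx = 1 /\ expi theta.2 ^+ Nt = 1.
Proof.
have expi_grid N (k : int) : (0 < N)%N -> expi (2 * k%:~R * pi / N%:R : R) ^+ N = 1.
  move=> N0; rewrite -expiMn -[RHS](expi_zpi2 k); congr expi.
  by field; rewrite pnatr_eq0 -lt0n.
by move=> Nx0 Nt0 [k [l [_ _ -> ->]]]; rewrite !expi_grid.
Qed.

Lemma expi_gamma_period x N : ~~ odd N -> expi x ^+ N = 1 -> expi (gamma x) ^+ N = 1.
Proof. by move=> Ne xN; rewrite expr_expi_gamma (negbTE Ne). Qed.

Lemma expi_double_period x N : ~~ odd N -> expi x ^+ N = 1 -> expi (2 * x) ^+ N./2 = 1.
Proof. by move=> Ne xN; rewrite expi2 -exprM mul2n even_halfK. Qed.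

Lemma harmfreq_period thetax thetat Nx Nt j : ~~ odd Nx -> ~~ odd Nt ->
  expi thetax ^+ Nx = 1 -> expi thetat ^+ Nt = 1 ->
  expi (tnth (harmfreq thetax thetat) j).1 ^+ Nx = 1
  /\ expi (tnth (harmfreq thetax thetat) j).2 ^+ Nt = 1.
Proof.
move=> Nxe Nte xN tN; rewrite (tnth_nth (0, 0)).
by case: j => [[|[|[|[|]]]]] //= _; rewrite ?expi_gamma_period.
Qed.

(** Since [gamma] negates the exponential, squaring identifies all four frequencies on the coarse
    grid. *)
Lemma harmfreq_double thetax thetat j :
  expi (2 * (tnth (harmfreq thetax thetat) j).1) = expi (2 * thetax)
  /\ expi (2 * (tnth (harmfreq thetax thetat) j).2) = expi (2 * thetat).
Proof.
rewrite (tnth_nth (0, 0)).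
by case: j => [[|[|[|[|]]]]] //= _; rewrite !expi2 ?expi_gamma ?sqrrN.
Qed.

End HarmonicFrequencies.

(** * Action of the operators on coefficient matrices *)

Section HarmonicAction.
Context {R : realType} {p Nt Nx : nat}.
Implicit Types (tau h omega : R) (psi psit : p.+1.-tuple {poly_p.+1 R}).
Implicit Types (U W : 'I_4 -> 'M[R[i]]_p.+1).
Local Notation N4 := (\sum_(j < 4) p.+1)%N.

Section BaseFrequency.
Context (thetax thetat : R).
Context (Nt0 : (0 < Nt)%N) (Nte : ~~ odd Nt) (Nx0 : (0 < Nx)%N) (Nxe : ~~ odd Nx).
Context (xN : expi thetax ^+ Nx = 1) (tN : expi thetat ^+ Nt = 1).
Local Notation freq j := (tnth (harmfreq thetax thetat) j).
Local Notation harm U := (harmvec thetax thetat U : gridvec R p Nt Nx).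

Lemma harmvec_morph (f : gridvec R p Nt Nx -> gridvec R p Nt Nx) A U :
  linear f -> (forall j w, f (mode (freq j) w) = mode (freq j) (A j *m w)) ->
  f (harm U) = harm (fun j => A j *m U j).
Proof.
move=> f_lin fA; rewrite !harmvecE (sum_of_linear f_lin); apply: eq_bigr => j _.
by rewrite fA mulmxA.
Qed.

Lemma harmvec_comb (c : R[i]) U W :
  harm U - c *: harm W = harm (fun j => U j - c *: W j).
Proof.
rewrite !harmvecE scaler_sumr -sumrB; apply: eq_bigr => j _.
by rewrite mulmxBl -scalemxAl modeBZ.
Qed.

Lemma system_harmvec tau h psi U : 0 < h ->
  system tau h psi (harm U) = harm (fun j => Lhat tau h psi (freq j) *m U j).
Proof.
move=> h0; apply: (harmvec_morph (f := system tau h psi)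
  (A := fun j => Lhat tau h psi (freq j))); first exact: system_is_linear.
move=> j w.
by have [jx jt] := harmfreq_period j Nxe Nte xN tN; exact: system_mode.
Qed.

Lemma blockdiag_inv_harmvec tau h psi U : 0 < tau -> 0 < h -> is_poly_basis psi ->
  blockdiag_inv tau h psi (harm U)
  = harm (fun j => invmx (Dhat tau h psi (freq j).1) *m U j).
Proof.
move=> tau0 h0 psiB; apply: (harmvec_morph (f := blockdiag_inv tau h psi)
  (A := fun j => invmx (Dhat tau h psi (freq j).1))); first exact: linearP.
move=> j w.
have [jx _] := harmfreq_period j Nxe Nte xN tN; exact: blockdiag_inv_mode.
Qed.

Lemma ShatE tau h psi omega theta : 0 < tau -> 0 < h -> is_poly_basis psi ->
  Shat tau h psi omega theta = 1%:M
    - omega%:C *: (invmx (Dhat tau h psi theta.1) *m Lhat tau h psi theta).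
Proof.
move=> tau0 h0 psiB; rewrite LhatE /Shat.
have -> : (1 - omega)%:C = 1 - omega%:C by rewrite rmorphB rmorph1.
by apply: damped_jacobi_mx; [exact: Ahat_unitmx | exact: Dhat_scale_neq0].
Qed.

(** Translates the frequencywise action of symbols into multiplication by one block diagonal
    matrix. *)
Lemma submxcol_mxdiag_mul m (A : 'I_4 -> 'M[R[i]]_p.+1) (V : 'M[R[i]]_(N4, m)) j :
  submxcol (\mxdiag_(j < 4) A j *m V) j = A j *m submxcol V j.
Proof. by rewrite -[in LHS](submxcolK V) mul_mxdiag_mxcol mxcolK. Qed.

Lemma smoother_harmvec tau h psi omega nu (V : 'M[R[i]]_(N4, p.+1)) :
  0 < tau -> 0 < h -> is_poly_basis psi ->
  smoother tau h psi omega nu (harm (submxcol V))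
  = harm (submxcol (Stilde tau h psi omega thetax thetat ^+ nu *m V)).
Proof.
move=> tau0 h0 psiB; elim: nu => [|nu IHnu]; first by rewrite expr0 mul1mx.
rewrite /smoother iterS -/(smoother _ _ _ _ _ _) IHnu.
rewrite system_harmvec // blockdiag_inv_harmvec // harmvec_comb.
congr harmvec; apply/funext => j.
rewrite exprS -[_ * _]/(_ *m _) -mulmxA submxcol_mxdiag_mul ShatE //.
by rewrite mulmxA mulmxBl mul1mx -[X in _ = _ - X]scalemxAl.
Qed.

Lemma restriction_is_linear tau psi psit :
  linear (restriction tau psi psit : gridvec R p Nt Nx -> gridvec R p Nt./2 Nx./2).
Proof.
move=> c u v; apply/ffunP => i; rewrite gridvec_combE !ffunE scaler_sumr -big_split.
apply: eq_bigr => s _; rewrite scaler_sumr -big_split; apply: eq_bigr => q _ /=.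
by rewrite gridvec_combE linearP scalerDr !scalerA mulrC.
Qed.

Lemma restriction_harmvec tau psi psit (V : 'M[R[i]]_(N4, p.+1)) :
  restriction tau psi psit (harm (submxcol V))
  = mode (2 * thetax, 2 * thetat)
      (Rtilde tau psi psit thetax thetat *m V *m const_mx 1).
Proof.
rewrite harmvecE (sum_of_linear (restriction_is_linear tau psi psit)).
rewrite -[V in RHS]submxcolK mul_mxrow_mxcol mulmx_suml.
rewrite (sum_of_linear (mode_is_linear _)).
apply: eq_bigr => j _.
have [jx jt] := harmfreq_period j Nxe Nte xN tN.
have [ex et] := harmfreq_double thetax thetat j.
rewrite (restriction_mode _ _ _ _ Nt0 Nx0 jx jt) mulmxA.
exact: (congr1 (fun f => f _) (@eq_mode _ _ _ _ (_, _) (2 * thetax, 2 * thetat) ex et)).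
Qed.

Lemma prolongation_harmvec tau psi psit (X : 'M[R[i]]_p.+1) :
  prolongation tau psi psit
    (mode (2 * thetax, 2 * thetat) (X *m const_mx 1) : gridvec R p Nt./2 Nx./2)
  = harm (submxcol (Ptilde tau psi psit thetax thetat *m X)).
Proof.
rewrite prolongation_mode // harmvecE; apply: eq_bigr => j _.
by rewrite mxcol_mul mxcolK mulmxA.
Qed.

End BaseFrequency.

End HarmonicAction.

(** * The coarse inverse on a single Fourier mode *)

Section CoarseSolve.
Context {R : realType} {p Nt Nx : nat}.
Implicit Types (tau h : R) (psi : p.+1.-tuple {poly_p.+1 R}).

Lemma Psi_mode (x t : R) (v : gridvec R p Nt Nx) :
  Psi x t v <-> exists w, v = mode (x, t) w.
Proof.
have PsiE (U : 'M[R[i]]_p.+1) :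
    [ffun i => U *m Phi (x, t) i] = mode (x, t) (U *m const_mx 1)
    :> gridvec R p Nt Nx.
  by apply/ffunP => i; rewrite ffunE modeE /Phi !expiMn -scalemxAr.
split=> [[U ->]|[w ->]]; first by exists (U *m const_mx 1).
(* The matrix with first column w and zeros elsewhere maps the vector of ones to w. *)
exists (w *m delta_mx 0 0); rewrite PsiE -mulmxA; congr mode.
rewrite -[LHS]mulmx1; congr (_ *m _); apply/matrixP => k l.
rewrite !ord1 !mxE (bigD1 0) //= !mxE big1 ?addr0 ?mulr1 // => s s0.
by rewrite !mxE (negbTE s0) andbF mul0r.
Qed.

Lemma mode_inj (theta : R * R) : (0 < Nt)%N -> (0 < Nx)%N ->
  injective (mode theta : 'cV[R[i]]_p.+1 -> gridvec R p Nt Nx).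
Proof.
move=> Nt0 Nx0 v w /ffunP /(_ (Ordinal Nt0, Ordinal Nx0)).
by rewrite !modeE /= !expr0 mulr1 !scale1r.
Qed.

(** Invertibility of the symbol is derived: a vector in its kernel gives a mode annihilated by the
    operator, and [Linv] undoes the operator on [Psi]. *)
Lemma inverse_on_system_mode tau h psi (x t : R)
    (Linv : gridvec R p Nt Nx -> gridvec R p Nt Nx) (w : 'cV[R[i]]_p.+1) :
  (0 < Nt)%N -> (0 < Nx)%N -> 0 < h ->
  expi x ^+ Nx = 1 -> expi t ^+ Nt = 1 ->
  inverse_on (Psi x t) (system tau h psi) Linv ->
  Linv (mode (x, t) w) = mode (x, t) (invmx (Lhat tau h psi (x, t)) *m w).
Proof.
move=> Nt0 Nx0 h0 xN tN [_ _ LK _].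
have Linv_mode v : Linv (mode (x, t) (Lhat tau h psi (x, t) *m v)) = mode (x, t) v.
  rewrite -system_mode //; apply: LK.
  by apply/mem_set/Psi_mode; exists v.
have Lu : Lhat tau h psi (x, t) \in unitmx.
  apply: ker_col0_unitmx => v Lv0; apply: (mode_inj (theta := (x, t)) Nt0 Nx0).
  by rewrite -(Linv_mode v) -[RHS]Linv_mode Lv0 mulmx0.
by rewrite -[w in LHS](mulKVmx Lu) Linv_mode.
Qed.

End CoarseSolve.

(** * Assembly of the two-grid iteration matrix *)

Theorem theorem3p24 (R : realType) (p Nt Nx nu1 nu2 : nat) (tau h omega : R)
    (psi psit : p.+1.-tuple {poly_p.+1 R}) (thetax thetat : R)
    (Linv : gridvec R p Nt./2 Nx./2 -> gridvec R p Nt./2 Nx./2) :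
  (0 < Nt)%N -> ~~ odd Nt -> (0 < Nx)%N -> ~~ odd Nx ->
  0 < tau -> 0 < h ->
  is_poly_basis psi -> is_poly_basis psit ->
  Theta_low Nx Nt (thetax, thetat) ->
  inverse_on (Psi (2 * thetax) (2 * thetat))
    (system (2 * tau) (2 * h) psit) Linv ->
  (forall u : gridvec R p Nt Nx, harmonics thetax thetat u ->
     harmonics thetax thetat (twogrid tau h psi psit omega nu1 nu2 Linv u))
  /\
  (forall U : 'I_4 -> 'M[R[i]]_p.+1,
     twogrid tau h psi psit omega nu1 nu2 Linv
       (harmvec thetax thetat U : gridvec R p Nt Nx)
     = harmvec thetax thetat
         (submxcol (Mtilde tau h psi psit omega nu1 nu2 thetax thetat
                    *m \mxcol_(j < 4) U j))).
Proof.
move=> Nt0 Nte Nx0 Nxe tau0 h0 psiB psitB [/(Theta_expi Nx0 Nt0) [/= xN tN] _] LinvP.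
set M := Mtilde _ _ _ _ _ _ _ _ _.
(* The coefficient formula implies the mapping property, as it exhibits the new coefficients. *)
suff twogridE (U : 'I_4 -> 'M[R[i]]_p.+1) :
    twogrid tau h psi psit omega nu1 nu2 Linv
      (harmvec thetax thetat U : gridvec R p Nt Nx)
    = harmvec thetax thetat (submxcol (M *m \mxcol_(j < 4) U j)).
  by split=> // u [U ->]; exists (submxcol (M *m \mxcol_(j < 4) U j)).
have half_pos N : (0 < N)%N -> ~~ odd N -> (0 < N./2)%N by case: N => [|[]].
set V := \mxcol_j U j.
have -> : harmvec thetax thetat U = harmvec thetax thetat (submxcol V) :> gridvec R p Nt Nx.
  by congr harmvec; apply/funext => j; rewrite mxcolK.
rewrite /twogrid smoother_harmvec //; set W := Stilde _ _ _ _ _ _ ^+ nu1 *m V.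
have LW : system tau h psi (harmvec thetax thetat (submxcol W) : gridvec R p Nt Nx)
    = harmvec thetax thetat (submxcol (Ltilde tau h psi thetax thetat *m W)).
  rewrite system_harmvec //; congr harmvec; apply/funext => j.
  by rewrite submxcol_mxdiag_mul.
rewrite LW restriction_harmvec //.
rewrite (inverse_on_system_mode _ _ _ _ _ _ LinvP) ?mulr_gt0 ?half_pos //;
  try exact: expi_double_period.
set X := Rtilde _ _ _ _ _ *m _; rewrite (mulmxA _ X) prolongation_harmvec //.
(* The scalar 1 gives the coarse correction the shape required by [harmvec_comb]. *)
rewrite -[harmvec _ _ (submxcol (Ptilde _ _ _ _ _ *m _))]scale1r harmvec_comb.
set Z := Ptilde _ _ _ _ _ *m _.
have -> : (fun j : 'I_4 => submxcol W j - 1 *: submxcol Z j) = submxcol (W - Z).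
  by apply/funext => j; rewrite scale1r submxcolB.
rewrite smoother_harmvec //; congr harmvec; congr submxcol.
rewrite /M /Mtilde -!mulmxA; congr (_ *m _).
by rewrite /Ktilde mulmxBl mul1mx /Z /X !mulmxA.
Qed.
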